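(* Fix an integer $k \geq 1$ and let $\rho = (1,k-1,1)$. For any shape $\lambda = (a,b,c)$ with integers $a \geq b \geq c \geq 0$ and $b\ge 1$, $$\vert \mathbb{S}((a,b,c),\rho) \vert = \begin{cases} \displaystyle\sum_{\substack{0 \leq i \leq a-b,\\ 0 \leq j \leq c}} \binom{k-2+i+j}{k-2,\,i,\,j}\, \vert \mathbb{S}((a-i,b-1,c-j),\rho) \vert, & \text{if } b > c;\\[22pt] \displaystyle\sum_{0 \leq i \leq a-b} \vert \mathbb{S}((a-i,b,c-1),\rho) \vert, & \text{if } b = c. \end{cases}$$
   Context: The Young diagram of shape $\lambda=(\lambda_1,\dots,\lambda_m)$ is the left-justified array with $\lambda_i$ cells in the $i$-th row from the top; $(i,j)$ is the cell in row $i$, column $j$. $\mathbb{S}(\lambda,\rho)$ is the set of standard set-valued Young tableaux of shape $\lambda$ and row-constant density $\rho=(\rho_1,\dots,\rho_m)$: assignments of the integers $1,\dots,M$, $M=\sum_i\lambda_i\rho_i$, to the cells so that each cell in row $i$ receives precisely $\rho_i$ integers (unordered within the cell), and for each cell $(i,j)$ every integer in it is smaller than every integer in the cells $(i+1,j)$ and $(i,j+1)$. Parts of a shape equal to $0$ mean the corresponding rows are empty. In the degenerate case $k=1$ the middle-row cells are empty and the tableaux are identified with standard Young tableaux formed by the first and third rows, i.e. the order condition is read as: every integer in cell $(i,j)$ is smaller than every integer in any other cell $(i',j')$ with $i'\ge i$, $j'\ge j$ (for positive densities this is equivalent to the condition above). Here $\binom{k-2+i+j}{k-2,i,j}=\frac{(k-2+i+j)!}{(k-2)!\,i!\,j!}$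 is the multinomial coefficient; for all $k\ge1$ it is read as $\frac{(k-1)k(k+1)\cdots(k-2+i+j)}{i!\,j!}$ (numerator a product of $i+j$ consecutive factors, the empty product being $1$), so that for $k=1$ it equals $1$ if $i=j=0$ and $0$ otherwise. *)

(* Defs.v *)
From mathcomp Require Import all_boot.

Set Implicit Arguments.
Unset Strict Implicit.
Unset Printing Implicit Defensive.

(* Rows and columns are numbered from 0, with row 0 at the top. *)
Definition cell (lam : seq nat) : finType :=
  {i : 'I_(size lam) & 'I_(nth 0 lam i)}.

Definition cell_row (lam : seq nat) (p : cell lam) : nat := tag p.
Definition cell_col (lam : seq nat) (p : cell lam) : nat := tagged p.

Definition num_entries (lam rho : seq nat) : nat :=
  \sum_(i < size lam) nth 0 lam i * nth 0 rho i.

(* A filling sends each integer to the cell that contains it; x : 'I_M stands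
   for the integer x + 1, so that 'I_M stands for {1, ..., M}. *)
Definition filling (lam rho : seq nat) : finType :=
  {ffun 'I_(num_entries lam rho) -> cell lam}.

Definition cell_content (lam rho : seq nat) (T : filling lam rho)
    (p : cell lam) : {set 'I_(num_entries lam rho)} := [set x | T x == p].

Definition has_density (lam rho : seq nat) (T : filling lam rho) : bool :=
  [forall p : cell lam, #|cell_content T p| == nth 0 rho (cell_row p)].

Definition entries_lt (lam rho : seq nat) (T : filling lam rho)
    (p q : cell lam) : bool :=
  [forall x in cell_content T p, forall y in cell_content T q, x < y].

Definition weakly_southeast (lam : seq nat) (p q : cell lam) : bool :=
  (cell_row p <= cell_row q) && (cell_col p <= cell_col q).

(* The order condition compares all pairs of cells, and not only adjacent ones,
   in order to be meaningful across rows of density 0. For positive densities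
   both conditions agree, see [is_standard_adjacent] below. *)
Definition is_standard (lam rho : seq nat) (T : filling lam rho) : bool :=
  [forall p : cell lam, forall q : cell lam,
     (p != q) && weakly_southeast p q ==> entries_lt T p q].

Definition ssvt (lam rho : seq nat) : {set filling lam rho} :=
  [set T | has_density T && is_standard T].

(* (k-2+i+j)! / ((k-2)! i! j!), written as (k-1) k ... (k-2+i+j) / (i! j!) so
   that it also covers k = 1; the division is exact, see [multinomE]. *)
Definition multinom (k i j : nat) : nat :=
  (\prod_(k.-1 <= t < k.-1 + (i + j)) t) %/ (i`! * j`!).

Lemma multinomE (k i j : nat) : 1 < k ->
  multinom k i j * ((k - 2)`! * i`! * j`!) = (k - 2 + i + j)`!.
Proof.
case: k => [//|[//|n]] _; rewrite /multinom subSS subSS subn0 /=.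
have factE m : \prod_(n.+1 <= t < n.+1 + m) t * n`! = (n + m)`!.
  elim: m => [|m IHm]; first by rewrite !addn0 big_geq // mul1n.
  rewrite addnS big_nat_recr ?leq_addr //= mulnAC IHm addnS factS mulnC.
  by rewrite addSn.
have dvd : i`! * j`! %| \prod_(n.+1 <= t < n.+1 + (i + j)) t.
  rewrite -(@dvdn_pmul2r n`!) ?fact_gt0 // factE.
  rewrite -(@bin_fact (n + (i + j)) n) ?leq_addr // addKn.
  rewrite -(@bin_fact (i + j) i) ?leq_addr // addKn.
  rewrite mulnCA mulnC dvdn_pmul2l ?fact_gt0 //.
  by rewrite mulnA dvdn_mull.
by rewrite -mulnA [n`! * _]mulnC mulnA divnK // factE addnA.
Qed.

Lemma multinom1 (i j : nat) : multinom 1 i j = (i == 0) && (j == 0).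
Proof.
rewrite /multinom /= add0n -[RHS]/(nat_of_bool _) -addn_eq0.
case Dn: (i + j) => [|n]; last by rewrite big_nat_recl // mul0n div0n.
by move/eqP: Dn; rewrite addn_eq0 => /andP[/eqP-> /eqP->]; rewrite big_geq.
Qed.

Lemma is_standard_adjacent (lam rho : seq nat) (T : filling lam rho) :
    sorted geq lam -> (forall i, i < size lam -> 0 < nth 0 rho i) ->
    has_density T ->
  is_standard T <->
  forall p q : cell lam,
    (cell_row q = (cell_row p).+1 /\ cell_col q = cell_col p) \/
    (cell_row q = cell_row p /\ cell_col q = (cell_col p).+1) ->
    entries_lt T p q.
Proof.
move=> lam_dec rho_gt0 /forallP densT.
have ne p : exists x, T x = p.
  have /card_gt0P[x] : 0 < #|cell_content T p|.
    by rewrite (eqP (densT p)) rho_gt0 // ltn_ord.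
  by rewrite inE => /eqP; exists x.
have ltP p q : reflect (forall x y, T x = p -> T y = q -> x < y)
                       (entries_lt T p q).
  apply: (iffP forall_inP) => H x.
    move=> y Tx Ty; have /H/forall_inP : x \in cell_content T p.
      by rewrite inE Tx.
    by apply; rewrite inE Ty.
  by rewrite inE => /eqP Tx; apply/forall_inP => y; rewrite inE => /eqP/H; apply.
have cell_eq (p q : cell lam) :
    cell_row p = cell_row q -> cell_col p = cell_col q -> p = q.
  case: p q => [i j] [i' j']; rewrite /cell_row /cell_col /= => /ord_inj eqi.
  by case: _ / eqi in j' * => /ord_inj->.
split=> [/forallP stdT p q adj | adjT].
  have /forallP/(_ q)/implyP := stdT p; apply; rewrite /weakly_southeast.
  have -> : p != q.
    apply/eqP=> eqpq; case: adj; rewrite eqpq => -[].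
      by move/n_Sn.
    by move=> _ /n_Sn.
  by case: adj => -[-> ->]; rewrite leqnn leqnSn.
apply/forallP=> p; apply/forallP=> q; apply/implyP=> /andP[neq_pq].
have [n] := ubnP ((cell_row q - cell_row p) + (cell_col q - cell_col p)).
elim: n => // n IHn in q neq_pq *; rewrite ltnS => le_n /andP[ler lec].
have step (r : cell lam) : weakly_southeast p r -> entries_lt T r q ->
    (cell_row r - cell_row p) + (cell_col r - cell_col p) < n ->
    entries_lt T p q.
  move=> sepr ltrq lt_n; have [-> //|neq_pr] := eqVneq p r.
  have /ltP ltpr := IHn r neq_pr lt_n sepr; move/ltP: ltrq => ltrq.
  apply/ltP=> x y Tx Ty; have [z Tz] := ne r.
  exact: ltn_trans (ltpr x z Tx Tz) (ltrq z y Tz Ty).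
case: q => [i j] in neq_pq le_n ler lec step *.
rewrite /cell_row /cell_col /= in ler lec le_n.
have /orP[ltr|/eqP eqr] : (cell_row p < i) || (cell_row p == i).
- by rewrite orbC -leq_eqVlt.
- have lt0i : 0 < i by apply: leq_ltn_trans ltr.
  have lti' : i.-1 < size lam by apply: leq_ltn_trans (leq_pred _) (ltn_ord i).
  have ltj' : j < nth 0 lam (Ordinal lti').
    apply: leq_trans (ltn_ord j) _ => /=.
    have := sorted_leq_nth (fun _ _ _ h1 h2 => leq_trans h2 h1) leqnn 0 lam_dec.
    by apply; rewrite ?inE ?leq_pred ?ltn_ord.
  apply: (step (existT _ (Ordinal lti') (Ordinal ltj'))).
  - by rewrite /weakly_southeast /cell_row /cell_col /= lec -ltnS prednK ?ltr.
  - by apply: adjT; left; rewrite /cell_row /cell_col /= prednK.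
  - rewrite /cell_row /cell_col /=; apply: leq_trans le_n.
    by rewrite ltn_add2r ltn_sub2r // ?prednK.
have /orP[/eqP eqc|ltc] : (cell_col p == j) || (cell_col p < j).
- by rewrite -leq_eqVlt.
- by case/eqP: neq_pq; apply: cell_eq.
have lt0j : 0 < j by apply: leq_ltn_trans ltc.
have ltj' : j.-1 < nth 0 lam i by apply: leq_ltn_trans (leq_pred _) (ltn_ord j).
apply: (step (existT _ i (Ordinal ltj'))).
- apply/andP; split; first by rewrite eqr; apply: leqnn.
  by rewrite -ltnS {2}/cell_col /= prednK.
- by apply: adjT; right; rewrite /cell_row /cell_col /= prednK.
- rewrite /cell_row /cell_col /=; apply: leq_trans le_n.
  by rewrite ltn_add2l ltn_sub2r // ?prednK.
Qed.

(* Main.v *)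
Require Import Defs.
From mathcomp Require Import all_boot.

(* Reading off the row of each of the integers 1, ..., M turns a tableau into a
   word over its rows, and this is a bijection onto the words in which an
   integer can only enter row i in column j once column j of every higher row
   is full. For three rows of densities 1, k-1, 1 the words are the lattice
   paths from the origin to (a, (k-1)b, c) that stay in the cone
   (k-1) r <= q <= (k-1) p, r <= p. If b > c, every position in which the last
   middle cell is partially filled and row 1 is long enough lies in the cone,
   so the final stretch of the path, from the smallest entry of that cell on, is
   arbitrary, and the multinomial coefficient counts the possible stretches. If
   b = c, only entries of the first row can follow the last entry of row 3. *)

(** * Row words of tableaux *)

Section RowWord.

Variables lam rho : seq nat.
Local Notation M := (num_entries lam rho).
Implicit Types (T : filling lam rho) (p q : cell lam) (i : 'I_(size lam)).

Lemma cell_inj p q :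
  cell_row p = cell_row q -> cell_col p = cell_col q -> p = q.
Proof.
case: p q => [i j] [i' j']; rewrite /cell_row /cell_col /= => /ord_inj eqi.
by case: _ / eqi in j' * => /ord_inj->.
Qed.

Lemma ssvtP {T} :
  reflect ((forall p, #|[set x | T x == p]| = nth 0 rho (cell_row p)) /\
           (forall x y, T x != T y -> weakly_southeast (T x) (T y) -> x < y))
          (T \in ssvt lam rho).
Proof.
rewrite inE; apply: (iffP andP) => -[dens std]; split.
- by move=> p; apply/eqP/(forallP dens).
- move=> x y neq se; move/forallP/(_ (T x))/forallP/(_ (T y)): std.
  by rewrite neq se => /forall_inP/(_ x); rewrite inE eqxx => /(_ isT)/forall_inP;
    apply; rewrite inE.
- by apply/forallP => p; apply/eqP/dens.
- apply/forallP => p; apply/forallP => q; apply/implyP => /andP[neq se].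
  apply/forall_inP => x; rewrite inE => /eqP Tx.
  by apply/forall_inP => y; rewrite inE => /eqP Ty; apply: std; rewrite Tx Ty.
Qed.

Definition row_word T : M.-tuple 'I_(size lam) := [tuple tag (T x) | x < M].

Lemma count_take_tuple (U : eqType) n (w : n.-tuple U) (u : U) m :
  count_mem u (take m w) = #|[set y : 'I_n | (y < m) && (tnth w y == u)]|.
Proof.
elim: m => [|m IHm]; first by rewrite take0 eq_card0 // => y; rewrite inE.
have [le_nm|lt_mn] := leqP n m.
  rewrite take_oversize ?size_tuple // in IHm.
  rewrite take_oversize ?size_tuple ?leqW //.
  rewrite IHm; apply: eq_card => y; rewrite !inE.
  by rewrite !(leq_trans (ltn_ord y)) // leqW.
rewrite (take_nth (tnth w (Ordinal lt_mn))) ?size_tuple //.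
rewrite -cats1 count_cat IHm /= addn0 -(tnth_nth _ w (Ordinal lt_mn)).
rewrite [RHS](cardsD1 (Ordinal lt_mn)) inE /= ltnSn andTb addnC; congr (_ + _).
apply: eq_card => y; rewrite !inE -val_eqE /= ltnS (leq_eqVlt y).
by case: (nat_of_ord y =P m) => [->|_] //=; rewrite ltnn.
Qed.

Lemma count_take_row_word T i m :
  count_mem i (take m (row_word T)) = #|[set y : 'I_M | (y < m) && (tag (T y) == i)]|.
Proof.
by rewrite count_take_tuple; apply: eq_card => y; rewrite !inE tnth_mktuple.
Qed.

Lemma card_row_prefix {T i m} : T \in ssvt lam rho -> m <= nth 0 lam i ->
  #|[set y | (tag (T y) == i) && (cell_col (T y) < m)]| = m * nth 0 rho i.
Proof.
case/ssvtP=> dens _; elim: m => [|m IHm] lem.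
  by rewrite eq_card0 // => y; rewrite inE andbF.
pose p : cell lam := existT _ i (Ordinal lem).
rewrite mulSn -(IHm (ltnW lem)) -(dens p) -cardsUI.
rewrite [X in _ + X]eq_card0 ?addn0.
  apply: eq_card => y; rewrite !inE.
  have -> : (T y == p) = (tag (T y) == i) && (cell_col (T y) == m).
    apply/eqP/andP => [->|[/eqP ei /eqP ej]]; first by rewrite !eqxx.
    by apply: cell_inj => //; rewrite /cell_row ei.
  by rewrite -andb_orr ltnS (leq_eqVlt (cell_col (T y))).
move=> y; rewrite !inE; apply/negbTE/negP => /andP[/eqP-> /andP[_]].
by rewrite /cell_col /= ltnn.
Qed.

(** Earlier columns of a row hold only smaller entries, and smaller entries lie in weakly earlier
    columns. So the column of [x] is the number of earlier letters of its row divided by the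
    density, which makes the word determine the tableau. *)
Lemma count_before_entry {T} x : T \in ssvt lam rho ->
  cell_col (T x) * nth 0 rho (tag (T x))
    <= count_mem (tag (T x)) (take x (row_word T))
    < (cell_col (T x)).+1 * nth 0 rho (tag (T x)).
Proof.
move=> ST; set i := tag (T x); set j := cell_col (T x); rewrite count_take_row_word.
have ltj : j < nth 0 lam i by apply: ltn_ord.
have [_ std] := ssvtP ST.
rewrite -!(card_row_prefix ST) ?(ltnW ltj) //; apply/andP; split.
  apply/subset_leq_card/subsetP => y; rewrite !inE => /andP[/eqP ey ltyj].
  rewrite ey eqxx andbT; apply: std.
    by apply: contraTneq ltyj => ->; rewrite ltnn.
  by rewrite /weakly_southeast /cell_row ey leqnn ltnW.
apply/proper_card/properP; split; last first.
  by exists x; rewrite !inE ?ltnn // eqxx ltnSn.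
apply/subsetP => y; rewrite !inE => /andP[ltyx /eqP ey].
rewrite ey eqxx /= ltnNge; apply: contraL ltyx => ltjy; rewrite -leqNgt ltnW //.
apply: std; last by rewrite /weakly_southeast /cell_row ey leqnn ltnW.
by apply: contraTneq ltjy => <-; rewrite ltnn.
Qed.

Lemma row_word_inj : {in ssvt lam rho &, injective row_word}.
Proof.
move=> T U ST SU eqw; apply/ffunP => x.
have eqt : tag (T x) = tag (U x).
  by move: (congr1 (fun w => tnth w x) eqw); rewrite !tnth_mktuple.
apply: cell_inj; first by rewrite /cell_row eqt.
have /andP[lT uT] := count_before_entry x ST.
have /andP[lU uU] := count_before_entry x SU.
rewrite eqt eqw in lT uT.
have := leq_ltn_trans lT uU; have := leq_ltn_trans lU uT.
by rewrite !ltn_mul2r !ltnS => /andP[_ h] /andP[_ h']; apply/eqP; rewrite eqn_leq h h'.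
Qed.

End RowWord.

(* The positivity condition is not redundant: n %/ 0 = 0, so rows of density 0
   would otherwise accept letters. *)
Definition admissible {m} (rho : seq nat) (u : seq 'I_m) (x : 'I_m) : bool :=
  (0 < nth 0 rho x) &&
  [forall i : 'I_m, (i < x) ==>
     ((count_mem x u %/ nth 0 rho x).+1 * nth 0 rho i <= count_mem i u)].

(** With all densities equal to 1 these are the lattice (Yamanouchi) words. *)
Definition ballot {m} (rho : seq nat) (w : seq 'I_m) : bool :=
  [forall n : 'I_(size w), admissible rho (take n w) (tnth (in_tuple w) n)].

Lemma ballotP {m} rho (w : seq 'I_m) :
  reflect (forall x0 n, n < size w -> admissible rho (take n w) (nth x0 w n))
          (ballot rho w).
Proof.
apply: (iffP forallP) => [ok x0 n ltn | ok n].
  by have := ok (Ordinal ltn); rewrite (tnth_nth x0).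
have x0 := tnth (in_tuple w) n.
by rewrite (tnth_nth x0); apply: ok.
Qed.

Lemma ballot_rcons {m} rho (w : seq 'I_m) x :
  ballot rho (rcons w x) = ballot rho w && admissible rho w x.
Proof.
apply/ballotP/andP => [ok|[/ballotP okw okx] x0 n].
  split; last first.
    have := ok x (size w); rewrite size_rcons ltnSn -cats1 take_size_cat //.
    by rewrite nth_cat ltnn subnn; apply.
  apply/ballotP => x0 n ltn; have := ok x0 n; rewrite size_rcons ltnS (ltnW ltn).
  by rewrite nth_rcons ltn -cats1 take_cat ltn; apply.
rewrite size_rcons ltnS -cats1 take_cat nth_cat; case: ltnP => [ltn _|le1 le2].
  exact: okw.
have -> : n = size w by apply/eqP; rewrite eqn_leq le1 le2.
by rewrite subnn /= cats0.
Qed.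

(** * Characterisation of the row words *)

Section Image.

Variables lam rho : seq nat.
Hypothesis lam_dec : sorted geq lam.
Local Notation M := (num_entries lam rho).

Definition row_words : {set M.-tuple 'I_(size lam)} :=
  [set w : M.-tuple 'I_(size lam) | ballot rho w &&
     [forall i : 'I_(size lam), count_mem i w == nth 0 lam i * nth 0 rho i]].

(** In a higher row, the cells up to the column of [x] lie weakly northwest of [x], so their entries
    precede it; these cells exist because the shape is weakly decreasing. *)
Lemma row_word_ballot T : T \in ssvt lam rho -> row_word lam rho T \in row_words.
Proof.
move=> ST; rewrite inE; apply/andP; split; last first.
  apply/forallP => i; rewrite -(card_row_prefix _ _ ST) //.
  rewrite -[tval _](@take_size _) count_take_row_word size_tuple.
  apply/eqP/eq_card => y; rewrite !inE ltn_ord /=.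
  by case: eqP => //= <-; rewrite ltn_ord.
apply/ballotP => x0 n; rewrite size_tuple => ltn.
rewrite -(tnth_nth _ _ (Ordinal ltn)) tnth_mktuple.
set x := Ordinal ltn; have /andP[lo hi] := count_before_entry _ _ x ST.
have rho_gt0 : 0 < nth 0 rho (tag (T x)).
  by move: (leq_ltn_trans lo hi); rewrite ltn_mul2r => /andP[].
rewrite /admissible rho_gt0; apply/forallP => i; apply/implyP => lti.
have -> : count_mem (tag (T x)) (take n (row_word lam rho T)) %/ nth 0 rho (tag (T x))
    = cell_col (T x).
  by apply/eqP; rewrite eqn_leq -ltnS ltn_divLR // hi leq_divRL.
have [_ std] := ssvtP _ _ ST.
rewrite -(card_row_prefix _ _ ST) ?count_take_row_word; last first.
  apply: leq_trans (ltn_ord (tagged (T x))) _.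
  apply: (sorted_leq_nth (fun _ _ _ h1 h2 => leq_trans h2 h1) leqnn 0 lam_dec);
    by rewrite ?inE ?ltn_ord ?(ltnW lti).
apply/subset_leq_card/subsetP => y; rewrite !inE => /andP[/eqP ey lty].
rewrite ey eqxx andbT; apply: (std y x).
  by apply: contraTneq lti => eyx; rewrite -ey eyx ltnn.
by rewrite /weakly_southeast /cell_row ey ltnW.
Qed.

Lemma num_cell_entries : \sum_(p : cell lam) nth 0 rho (cell_row p) = M.
Proof.
rewrite -(sig_big_dep (J := fun i : 'I_(size lam) => 'I_(nth 0 lam i)) predT
            (fun _ => predT) (fun i _ => nth 0 rho i)).
by apply: eq_bigr => i _; rewrite sum_nat_const card_ord.
Qed.

(** The inverse map puts [x] in row [tnth w x], in the column given by the quotient of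
    [count_before_entry]. *)
Lemma ballot_row_word w : w \in row_words ->
  exists2 T, T \in ssvt lam rho & w = row_word lam rho T.
Proof.
rewrite inE => /andP[/ballotP bal /forallP cnt].
pose before i n := count_mem i (take n w).
have before_mono i n n' : n <= n' -> before i n <= before i n'.
  move=> le; rewrite /before -(cat_take_drop n (take n' w)) count_cat.
  by rewrite take_takel // leq_addr.
have beforeS x : before (tnth w x) x.+1 = (before (tnth w x) x).+1.
  rewrite /before (take_nth (tnth w x)) ?size_tuple // -cats1 count_cat /=.
  by rewrite -tnth_nth eqxx addn0 addn1.
have before_lt x y : tnth w x = tnth w y ->
    (before (tnth w x) x < before (tnth w y) y) = (x < y).
  move=> e; apply/idP/idP => lt.
    by rewrite ltnNge; apply: contraL lt => le; rewrite -leqNgt e before_mono.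
  by rewrite -beforeS e before_mono.
have adm (x : 'I_M) : admissible rho (take x w) (tnth w x).
  by rewrite (tnth_nth (tnth w x)); apply: bal; rewrite size_tuple.
have rho_gt0 x : 0 < nth 0 rho (tnth w x) by case/andP: (adm x).
have col_lt x : before (tnth w x) x %/ nth 0 rho (tnth w x) < nth 0 lam (tnth w x).
  rewrite ltn_divLR // -(eqP (cnt _)) -beforeS /before.
  by rewrite -{2}(cat_take_drop x.+1 w) count_cat leq_addr.
pose T : filling lam rho := [ffun x => existT _ (tnth w x) (Ordinal (col_lt x))].
have rowT x : tag (T x) = tnth w x by rewrite ffunE.
have colT x : cell_col (T x) = before (tnth w x) x %/ nth 0 rho (tnth w x).
  by rewrite ffunE.
exists T; last by apply: eq_from_tnth => x; rewrite tnth_mktuple rowT.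
apply/ssvtP; split=> [p|x y neq /andP[]].
  (* No cell gets more than its density, and the totals agree. *)
  have fibre_le q : #|[set x | T x == q]| <= nth 0 rho (cell_row q) ?= iff
      (#|[set x | T x == q]| == nth 0 rho (cell_row q)).
    split=> //; set S := [set x | _].
    have rowS x : x \in S -> tnth w x = tag q by rewrite inE => /eqP <-; rewrite rowT.
    have colS x : x \in S -> before (tag q) x %/ nth 0 rho (tag q) = cell_col q.
      by move=> Sx; move: (Sx); rewrite inE => /eqP <-; rewrite colT rowT.
    have [->|[x Sx]] := set_0Vmem S; first by rewrite cards0.
    have rho_q : 0 < nth 0 rho (tag q) by rewrite -(rowS x Sx).
    rewrite -[leqRHS]card_ord.
    (* Entries of one cell share the quotient of their rank by the density, so the remainder
       determines the rank and hence the entry. *)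
    pose pos (y : 'I_M) := Ordinal (ltn_pmod (before (tag q) y) rho_q).
    rewrite -(card_in_imset (f := pos)) ?max_card // => y z Sy Sz [eqmod].
    have eqb : before (tag q) y = before (tag q) z.
      by rewrite (divn_eq (before _ y) (nth 0 rho (tag q))) eqmod colS // -(colS z) // -divn_eq.
    have eqw : tnth w y = tnth w z by rewrite !rowS.
    have := before_lt _ _ eqw; have := before_lt _ _ (esym eqw).
    by rewrite !rowS // eqb ltnn; case: ltngtP => // /ord_inj.
  have [_] := @leqif_sum _ xpredT _ _ _ (fun q _ => fibre_le q).
  rewrite num_cell_entries.
  have -> : \sum_(q : cell lam) #|[set x | T x == q]| = M.
    rewrite -[RHS]card_ord -sum1_card (partition_big T xpredT) //=.
    by apply: eq_bigr => q _; rewrite -sum1_card; apply: eq_bigl => x; rewrite inE.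
  by rewrite eqxx => /esym/forallP/(_ p)/eqP.
rewrite /cell_row !rowT !colT leq_eqVlt => /orP[/eqP/ord_inj e | lt] le.
  (* Same row: [y <= x] would put [y] in a weakly earlier column, hence in the cell of [x]. *)
  rewrite ltnNge; apply: contra neq => leyx; apply/eqP/cell_inj.
    by rewrite /cell_row !rowT e.
  apply/eqP; rewrite eqn_leq !colT le -e.
  by apply/leq_div2r/before_mono.
(* [x] in a higher row: admissibility at [y] fills that row through the column of [y], so [y <= x]
   would put [x] in a later column. *)
have /andP[_ /forallP/(_ (tnth w x))] := adm y.
rewrite lt /= -/(before _ _) -/(before _ _) => full.
rewrite ltnNge; apply/negP => leyx.
have := leq_trans full (before_mono (tnth w x) _ _ leyx).
rewrite leqNgt => /negP; apply; rewrite -ltn_divLR // ltnS.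
Qed.

Lemma card_ssvt : #|ssvt lam rho| = #|row_words|.
Proof.
rewrite -(card_in_imset (row_word_inj lam rho)); apply: eq_card => w.
by apply/imsetP/idP => [[T ST ->]|/ballot_row_word//]; apply: row_word_ballot.
Qed.

End Image.

(** * Recurrences for the multinomial coefficient *)

Lemma multinom_prod (t i j : nat) :
  multinom t.+1 i j * (i`! * j`!) = \prod_(t <= s < t + (i + j)) s.
Proof.
case: t => [|t]; last first.
  apply/eqP; rewrite -(eqn_pmul2r (fact_gt0 t)) -mulnA [_ * t`!]mulnC [t`! * _]mulnA.
  have := @multinomE t.+2 i j isT; rewrite subSS subSS subn0 => ->.
  rewrite !fact_prod mulnC -big_cat_nat ?ltnS ?leq_addr //.
  by rewrite -addnA addSn.
rewrite multinom1 add0n -addn_eq0.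
have [e|ne] := eqVneq (i + j) 0; last first.
  by rewrite mul0n; case: (i + j) ne => // n _; rewrite big_nat_recl // mul0n.
by move/eqP: (e); rewrite addn_eq0 => /andP[/eqP-> /eqP->]; rewrite big_geq.
Qed.

(** For [i + j > 0], after multiplication by [i! j!] all terms share the factor [(t+1)...(t+i+j-1)];
    what remains is that the top factor [t + i + j] is the sum of [t], [i] and [j]. *)
Lemma multinom_pascal t i j :
  multinom t.+2 i j = multinom t.+1 i j
    + (if i is i'.+1 then multinom t.+2 i' j else 0)
    + (if j is j'.+1 then multinom t.+2 i j' else 0).
Proof.
apply/eqP; rewrite -(@eqn_pmul2r (i`! * j`!)) ?muln_gt0 ?fact_gt0 //; apply/eqP.
rewrite !mulnDl !multinom_prod.
have -> : (if i is i'.+1 then multinom t.+2 i' j else 0) * (i`! * j`!)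
    = i * \prod_(t.+1 <= s < t + (i + j)) s.
  case: i => [//|i]; rewrite factS -mulnA mulnCA multinom_prod.
  by rewrite !addSn addnS.
have -> : (if j is j'.+1 then multinom t.+2 i j' else 0) * (i`! * j`!)
    = j * \prod_(t.+1 <= s < t + (i + j)) s.
  case: j => [//|j]; rewrite factS [i`! * _]mulnCA mulnCA multinom_prod.
  by rewrite !addSn !addnS.
rewrite -addnA -mulnDl addSn; case: (i + j) => [|n].
  by rewrite !addn0 !big_geq.
rewrite !addnS big_nat_recr ?ltnS ?leq_addr //=.
rewrite [X in _ = X + _]big_ltn ?ltnS ?leq_addr //.
by rewrite -mulnDl mulnC addnS.
Qed.

(* Here t is the number of integers in the last middle cell. Since
   multinom 1 i j is 1 at i = j = 0 and 0 elsewhere, an induction on t can start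
   from the empty cell, which also covers k = 1. *)
Definition convolution (t : nat) (F : nat -> nat -> nat) (P r : nat) : nat :=
  \sum_(0 <= i < P.+1) \sum_(0 <= j < r.+1) multinom t.+1 i j * F (P - i) (r - j).

Lemma convolution0 F P r : convolution 0 F P r = F P r.
Proof.
rewrite /convolution big_nat_recl // [X in X + _]big_nat_recl // !subn0.
rewrite multinom1 mul1n [X in _ + X + _]big1 ?addn0 => [|j _]; last first.
  by rewrite multinom1.
by rewrite big1 ?addn0 // => i _; rewrite big1 // => j _; rewrite multinom1.
Qed.

(** Pascal's rule termwise, with [i] or [j] shifted in the last two sums. The result has the shape
    of the last-step recurrence for lattice paths. *)
Lemma convolutionS t F P r :
  convolution t.+1 F P r = convolution t F P r
    + (if P is P'.+1 then convolution t.+1 F P' r else 0)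
    + (if r is r'.+1 then convolution t.+1 F P r' else 0).
Proof.
rewrite /convolution.
under eq_bigr => i _ do
  (under eq_bigr => j _ do rewrite multinom_pascal !mulnDl; rewrite !big_split).
rewrite !big_split /=; congr (_ + _ + _).
  rewrite big_nat_recl // big1 ?add0n => [|j _]; last by rewrite mul0n.
  case: P => [|P]; first by rewrite big_geq.
  by apply: eq_bigr => i _; apply: eq_bigr => j _; rewrite subSS.
case: r => [|r].
  by apply: big1 => i _; rewrite big_nat1 mul0n.
by apply: eq_bigr => i _; rewrite big_nat_recl.
Qed.

(** * Lattice paths in the cone *)

Lemma card_tuple_rcons (U : finType) n (P : pred (seq U)) :
  #|[set w : n.+1.-tuple U | P w]| = \sum_(x : U) #|[set w : n.-tuple U | P (rcons w x)]|.
Proof.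
pose f (xw : U * n.-tuple U) := [tuple of rcons xw.2 xw.1].
have f_inj : injective f.
  move=> [x w] [y v] /(congr1 val) /= /rcons_inj [e ->].
  by congr (_, _); apply: val_inj.
have f_bij : bijective f by apply: inj_card_bij; rewrite // card_prod !card_tuple expnS.
rewrite -sum1_card (reindex f) /=; last exact: onW_bij.
under [RHS]eq_bigr => x _ do rewrite -sum1_card.
rewrite pair_big_dep /=; apply: eq_bigl => -[x w].
by rewrite !inE.
Qed.

Section ThreeRows.

Variable k : nat.
Local Notation rho := [:: 1; k - 1; 1].

(** For [k = 1] the first two inequalities only force [q = 0], and [r <= p] carries the condition
    between the outer rows. *)
Definition in_cone (p q r : nat) : bool :=
  [&& q <= p * (k - 1), r * (k - 1) <= q & r <= p].

Definition has_counts (p q r : nat) (w : seq 'I_3) : bool :=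
  [forall i : 'I_3, count_mem i w == nth 0 [:: p; q; r] i].

Definition num_paths (n p q r : nat) : nat :=
  #|[set w : n.-tuple 'I_3 | ballot rho w && has_counts p q r w]|.

Definition row (i : nat) : 'I_3 := inord i.

Lemma has_countsP p q r w : reflect
  [/\ count_mem (row 0) w = p, count_mem (row 1) w = q & count_mem (row 2) w = r]
  (has_counts p q r w).
Proof.
apply: (iffP forallP) => [cnt|[<- <- <-] i].
  by split; apply/eqP; rewrite (eqP (cnt _)) inordK.
by case: i => -[|[|[|//]]] lti; apply/eqP; rewrite /=;
  apply: eq_count => x; rewrite /= -!val_eqE /= inordK.
Qed.

Lemma row_cases (x : 'I_3) : [\/ x = row 0, x = row 1 | x = row 2].
Proof.
by case: x => -[|[|[|//]]] lti; [constructor 1|constructor 2|constructor 3];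
  apply: val_inj; rewrite /= inordK.
Qed.

Definition counts_in_cone (w : seq 'I_3) : bool :=
  in_cone (count_mem (row 0) w) (count_mem (row 1) w) (count_mem (row 2) w).

Lemma row_eq i j : i < 3 -> j < 3 -> (row i == row j) = (i == j).
Proof. by move=> lti ltj; rewrite -val_eqE /= !inordK. Qed.

(** Only the coordinate of the new letter grows, so testing that letter means testing the
    inequalities which this coordinate can violate. *)
Lemma admissible_in_cone w x : counts_in_cone w ->
  admissible rho w x = counts_in_cone (rcons w x).
Proof.
rewrite /counts_in_cone /in_cone -!cats1 !count_cat /= !addn0.
set p := count_mem (row 0) w; set q := count_mem (row 1) w.
set r := count_mem (row 2) w.
case/and3P=> qp rq rp.
have adm : admissible rho w x = (0 < nth 0 rho x) &&
   ((0 < x) ==> ((count_mem x w %/ nth 0 rho x).+1 <= p)) &&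
   ((1 < x) ==> ((count_mem x w %/ nth 0 rho x).+1 * (k - 1) <= q)).
  rewrite /admissible -andbA; congr (_ && _).
  apply/forallP/andP => [H|[H0 H1] i].
    split.
      by move: (H (row 0)); rewrite inordK //= muln1.
    by move: (H (row 1)); rewrite inordK.
  case: (row_cases i) => ->; rewrite inordK //= ?muln1 //.
  by apply/implyP => lt2x; move: (ltn_ord x); rewrite ltnS leqNgt lt2x.
rewrite {}adm; case: (row_cases x) => ->; rewrite !row_eq //= !inordK //= -/p -/q -/r.
- by rewrite addn1 !addn0 leqW // rq (leq_trans qp) // leq_mul2r leqnSn orbT.
- rewrite addn1 !addn0 rp !andbT (leq_trans rq) // andbT.
  (* For density 0 the positivity test and the cone inequality both fail. *)
  have [->|] := posnP (k - 1); first by rewrite muln0.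
  by move=> k_gt0; rewrite ltn_divLR.
- by rewrite addn1 !addn0 divn1 qp /= andbC.
Qed.

Lemma ballot_in_cone w : ballot rho w -> counts_in_cone w.
Proof.
elim/last_ind: w => [|w x IHw] //; rewrite ballot_rcons => /andP[/IHw st].
by rewrite admissible_in_cone.
Qed.

Lemma num_paths_eq0 n p q r : ~~ in_cone p q r -> num_paths n p q r = 0.
Proof.
move=> nV; apply: eq_card0 => w; rewrite inE; apply: contraNF nV.
by case/andP=> /ballot_in_cone + /has_countsP[<- <- <-].
Qed.

Lemma num_pathsS n p q r : in_cone p q r ->
  num_paths n.+1 p q r = (if p is p'.+1 then num_paths n p' q r else 0)
    + (if q is q'.+1 then num_paths n p q' r else 0)
    + (if r is r'.+1 then num_paths n p q r' else 0).
Proof.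
move=> V; rewrite /num_paths (card_tuple_rcons _ _ (fun w => ballot rho w && has_counts p q r w)).
(* Since the endpoint lies in the cone, the last letter is admissible whenever the rest is a ballot
   word. *)
have E (w : seq 'I_3) x : ballot rho (rcons w x) && has_counts p q r (rcons w x)
    = ballot rho w && has_counts p q r (rcons w x).
  rewrite ballot_rcons -andbA; have [/ballot_in_cone st|//] := boolP (ballot rho w).
  rewrite admissible_in_cone //; have [/has_countsP[e0 e1 e2]|] := boolP (has_counts _ _ _ _).
    by rewrite /counts_in_cone e0 e1 e2 V.
  by rewrite andbF.
rewrite !big_ord_recl big_ord0 addn0 addnA.
have cnt (x : 'I_3) (w : seq 'I_3) : has_counts p q r (rcons w x) =
   [&& count_mem (row 0) w + (x == row 0) == p, count_mem (row 1) w + (x == row 1) == q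
     & count_mem (row 2) w + (x == row 2) == r].
  by apply/has_countsP/and3P; rewrite -!cats1 !count_cat /= !addn0 => -[/eqP ? /eqP ? /eqP ?].
have cnt' p' q' r' (w : seq 'I_3) : has_counts p' q' r' w =
   [&& count_mem (row 0) w == p', count_mem (row 1) w == q' & count_mem (row 2) w == r'].
  by apply/has_countsP/and3P=> -[/eqP ? /eqP ? /eqP ?].
congr (_ + _ + _).
- have -> : ord0 = row 0 by apply: val_inj; rewrite /= inordK.
  by case: p V E cnt => [|p'] V E cnt; [apply: eq_card0 | apply: eq_card] => w;
    rewrite !inE E cnt ?cnt' !row_eq //= !addn0 addn1 ?andbF.
- have -> : lift ord0 ord0 = row 1 by apply: val_inj; rewrite /= inordK.
  by case: q V E cnt => [|q'] V E cnt; [apply: eq_card0 | apply: eq_card] => w;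
    rewrite !inE E cnt ?cnt' !row_eq //= !addn0 addn1 ?andbF.
- have -> : lift ord0 (lift ord0 ord0) = row 2 by apply: val_inj; rewrite /= inordK.
  by case: r V E cnt => [|r'] V E cnt; [apply: eq_card0 | apply: eq_card] => w;
    rewrite !inE E cnt ?cnt' !row_eq //= !addn0 addn1 ?andbF.
Qed.

End ThreeRows.

Definition paths (k p q r : nat) : nat := num_paths k (p + q + r) p q r.

(** A positive first coordinate makes the word nonempty, so there is a last letter to remove. *)
Lemma pathsS k p q r : in_cone k p.+1 q r ->
  paths k p.+1 q r = paths k p q r
    + (if q is q'.+1 then paths k p.+1 q' r else 0)
    + (if r is r'.+1 then paths k p.+1 q r' else 0).
Proof.
move=> V; rewrite /paths !addSn num_pathsS //; congr (_ + _ + _).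
  by case: q V => // q V; rewrite !addnS !addSn.
by case: r V => // r V; rewrite !addnS !addSn.
Qed.

Lemma paths_eq0 k p q r : ~~ in_cone k p q r -> paths k p q r = 0.
Proof. exact: num_paths_eq0. Qed.

Lemma card_ssvt_paths k a b c : b <= a -> c <= b ->
  #|ssvt [:: a; b; c] [:: 1; k - 1; 1]| = paths k a (b * (k - 1)) c.
Proof.
move=> leba lecb; rewrite card_ssvt /= ?leba ?lecb // /paths.
have -> : a + b * (k - 1) + c = num_entries [:: a; b; c] [:: 1; k - 1; 1].
  by rewrite /num_entries !big_ord_recl big_ord0 /= !muln1 addn0 addnA.
apply: eq_card => w; rewrite !inE; congr (_ && _).
by apply: eq_forallb => -[[|[|[|//]]] lti]; rewrite /= ?muln1.
Qed.

(** * The final stretch of a path *)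

(** The first row already covers column [b], and the third row has not entered it. *)
Lemma in_cone_last_middle_cell k b r P t : r <= b -> t <= k - 1 ->
  in_cone k (b.+1 + P) (b * (k - 1) + t) r.
Proof.
move=> lerb letk; apply/and3P; split.
- by rewrite mulnDl mulSnr -addnA leq_add2l (leq_trans letk) ?leq_addr.
- by rewrite (leq_trans _ (leq_addr _ _)) // leq_mul2r lerb orbT.
- by rewrite (leq_trans lerb) // (leq_trans (leqnSn _)) ?leq_addr.
Qed.

(** Both sides obey the same recurrence in [t], [P] and [r]. For [t > 0], [multinom t.+1 i j] counts
    the orders of the [t - 1] later entries of the cell, [i] of the first row and [j] of the
    third. *)
Lemma paths_last_middle_cell k b r P t : r <= b -> t <= k - 1 ->
  paths k (b.+1 + P) (b * (k - 1) + t) r =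
  convolution t (fun P' r' => paths k (b.+1 + P') (b * (k - 1)) r') P r.
Proof.
elim: t r P => [|t IHt] r P lerb letk; first by rewrite convolution0 addn0.
(* With only [b] letters of the first row, column [b] of the middle row is still closed; this gives
   the zero branch at [P' = 0]. *)
have first_row_full r' : paths k b (b * (k - 1) + t.+1) r' = 0.
  by apply: paths_eq0; rewrite /in_cone addnS -ltn_subRL subnn.
have step P' r' : r' <= b -> paths k (b.+1 + P') (b * (k - 1) + t.+1) r' =
    paths k (b.+1 + P') (b * (k - 1) + t) r'
    + (if P' is P''.+1 then paths k (b.+1 + P'') (b * (k - 1) + t.+1) r' else 0)
    + (if r' is r''.+1 then paths k (b.+1 + P') (b * (k - 1) + t.+1) r'' else 0).
  move=> lerb'; rewrite {1}addSn pathsS -?addSn ?in_cone_last_middle_cell //.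
  rewrite -?addSn addnS [paths k (b + P') _ _ + _]addnC; congr (_ + _ + _).
  by case: P' => [|P'']; rewrite ?addSnnS // addn0 -addnS first_row_full.
elim: P r lerb => [|P IHP]; elim=> [|r IHr] lerb;
  by rewrite convolutionS step // IHt ?(ltnW letk) // ?IHP // ?IHr // ltnW.
Qed.

(** The endpoint lies on the wall [r * (k - 1) = q], so undoing a middle step leaves the cone: the
    path ends with a third-row step followed by [i] first-row steps. *)
Lemma paths_last_bottom_cell k b P :
  paths k (b.+1 + P) (b.+1 * (k - 1)) b.+1 =
  \sum_(0 <= i < P.+1) paths k (b.+1 + (P - i)) (b.+1 * (k - 1)) b.
Proof.
have cone P' : in_cone k (b.+1 + P') (b.+1 * (k - 1)) b.+1.
  by rewrite /in_cone leqnn leq_mul2r !leq_addr orbT.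
have no_middle p : (if b.+1 * (k - 1) is q'.+1 then paths k p q' b.+1 else 0) = 0.
  case Dq: (b.+1 * (k - 1)) => [//|q]; apply: paths_eq0.
  by rewrite /in_cone Dq ltnn andbF.
elim: P => [|P IHP]; rewrite addSn pathsS -?addSn ?cone // no_middle addn0.
  (* At [P = 0], undoing a first-row step would give [r > p]. *)
  by rewrite big_nat1 paths_eq0 ?add0n // /in_cone addn0 ltnn !andbF.
by rewrite -addSnnS IHP [RHS]big_nat_recl // addnC.
Qed.

Theorem proposition3p3 (k a b c : nat) (hk : 1 <= k)
    (hab : b <= a) (hbc : c <= b) (hb : 1 <= b) :
  #|ssvt [:: a; b; c] [:: 1; k - 1; 1]| =
  if c < b then
    \sum_(0 <= i < (a - b).+1) \sum_(0 <= j < c.+1)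
      multinom k i j * #|ssvt [:: a - i; b - 1; c - j] [:: 1; k - 1; 1]|
  else
    \sum_(0 <= i < (a - b).+1)
      #|ssvt [:: a - i; b; c - 1] [:: 1; k - 1; 1]|.
Proof.
rewrite card_ssvt_paths //; case: b hb => // b _ in hab hbc *.
(* Keeps the smaller shapes weakly decreasing, as [card_ssvt_paths] requires. *)
have le_sub i : i < (a - b.+1).+1 -> b.+1 <= a - i.
  by rewrite ltnS => lei; rewrite leq_subRL ?(leq_trans lei) ?leq_subr // addnC -leq_subRL.
rewrite -{1}(subnKC hab); case: ltnP => [lecb|ltbc].
  (* The last middle cell is split off; it is full, so [t = k - 1]. *)
  rewrite mulSnr paths_last_middle_cell // [b.+1 - 1]subn1 /=.
  apply: eq_big_nat => i /andP[_ /[dup] lei /le_sub leb].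
  apply: eq_big_nat => j _.
  (* Subtraction is truncated, so [1 <= k] is what turns [(k - 1).+1] into [k]. *)
  rewrite -[(k - 1).+1]addn1 subnK // card_ssvt_paths ?(ltnW leb) ?(leq_trans (leq_subr _ _)) //.
  by rewrite addnBA // subnKC.
have -> : c = b.+1 by apply/eqP; rewrite eqn_leq hbc.
rewrite paths_last_bottom_cell [b.+1 - 1]subn1 /=.
apply: eq_big_nat => i /andP[_ /[dup] lei /le_sub leb].
by rewrite card_ssvt_paths // addnBA // subnKC.
Qed.
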